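(* Let $\ell\ge2$ and let $L=[\delta_{ij}]_{i,j\in[\ell]}$ be a Latin square of order $\ell$ with symbols in $[\ell]=\{1,\ldots,\ell\}$. For each $a\in[\ell]$ let $S^{(a)}$ be a multiset of $n_S$ vectors in $\mathbb{Q}^{r_S}$ and $T^{(a)}$ a multiset of $n_T$ vectors in $\mathbb{Q}^{r_T}$, and define the multiset $U^{(a)}=\bigcup_{i=1}^{\ell}S^{(i)}\times T^{(\delta_{ai})}\subset\mathbb{Q}^{r_S+r_T}$ (multiset union of $\ell n_Sn_T$ vectors). Suppose that $[S^{(a)}]=^{n_S}_{m_S}[S^{(b)}]$ and $[T^{(a)}]=^{n_T}_{m_T}[T^{(b)}]$ for all distinct $a,b\in[\ell]$. Then $[U^{(a)}]=^{\ell n_Sn_T}_{m_S+m_T+1}[U^{(b)}]$ for all distinct $a,b\in[\ell]$.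
   Context: A Latin square of order $\ell$ is an $\ell\times\ell$ array with $\ell$ symbols in which each symbol appears exactly once in each row and each column. For multisets $S\subset\mathbb{Q}^{r_S}$, $T\subset\mathbb{Q}^{r_T}$, $S\times T$ is the multiset of all concatenations $(s_1,\ldots,s_{r_S},t_1,\ldots,t_{r_T})$ with $\mathbf{s}\in S$, $\mathbf{t}\in T$ (counted with multiplicity). For multisets $A=\{\mathbf{a}_1,\ldots,\mathbf{a}_n\}$, $B=\{\mathbf{b}_1,\ldots,\mathbf{b}_n\}\subset\mathbb{Q}^r$ with $\mathbf{a}_i=(a_{i1},\ldots,a_{ir})$, $\mathbf{b}_i=(b_{i1},\ldots,b_{ir})$, $[A]=^n_m[B]$ means $A,B$ have no common element and $\sum_i\prod_j a_{ij}^{k_j}=\sum_i\prod_j b_{ij}^{k_j}$ for all nonnegative integers $k_j$ with $1\le\sum_jk_j\le m$. *)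

(* Defs.v *)
From mathcomp Require Import all_boot all_order all_algebra.
From mathcomp Require Export finmap multiset.

Set Implicit Arguments.
Unset Strict Implicit.
Unset Printing Implicit Defensive.

Import GRing.Theory.
Local Open Scope mset_scope.
Local Open Scope ring_scope.

(* Rows, columns and symbols, all indexed by [l] in the mathematics, are
   indexed by 'I_l = {0, ..., l-1}. *)
Definition latin_square (l : nat) (L : 'M['I_l]_l) : Prop :=
  (forall i c : 'I_l, exists! j : 'I_l, L i j = c) /\
  (forall j c : 'I_l, exists! i : 'I_l, L i j = c).

(* The product S x T: the library's msetM is a multiset of pairs, whereas here
   the pairs are concatenated into vectors of length r + s. *)
Definition mset_concat (r s : nat)
    (S : {mset 'rV[rat]_r}) (T : {mset 'rV[rat]_s}) : {mset 'rV[rat]_(r + s)} :=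
  seq_mset [seq row_mx x y | x <- enum_mset S, y <- enum_mset T].

(* [A] =^n_m [B].  The sums range over the enumeration of a multiset, in which
   each element is repeated according to its multiplicity. *)
Definition pte (n m r : nat) (A B : {mset 'rV[rat]_r}) : Prop :=
  [/\ size A = n,
      size B = n,
      (forall x : 'rV[rat]_r, ~ (x \in A /\ x \in B)) &
      forall k : 'I_r -> nat, (1 <= \sum_(j < r) k j <= m)%N ->
        \sum_(x <- A) \prod_(j < r) x ord0 j ^+ k j =
        \sum_(x <- B) \prod_(j < r) x ord0 j ^+ k j].

(* The union is the additive one (msetD): multiplicities add up. *)
Definition latin_mset (l r s : nat) (L : 'M['I_l]_l)
    (S : 'I_l -> {mset 'rV[rat]_r}) (T : 'I_l -> {mset 'rV[rat]_s})
    (a : 'I_l) : {mset 'rV[rat]_(r + s)} :=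
  \big[msetD/mset0]_(i < l) mset_concat (S i) (T (L a i)).

(* Main.v *)
Require Import Defs.
From mathcomp Require Import all_boot all_order all_algebra.

(** The moment of [U^(a)] with exponents [(k, k')] is [sum_i P_i Q_(L a i)],
    where [P_i] and [Q_c] are the moments of [S^(i)] and [T^(c)] with exponents
    [k] and [k'].  If the total degree is at most [mS + mT + 1], then either
    [|k| <= mS], so that [P] is constant, or [|k'| <= mT], so that [Q] is
    constant.  A sum over a row of a Latin square in which one factor is constant
    does not depend on the row.  For disjointness, the [S]-part of a common
    vector determines the column [i], and its [T]-part then forces
    [L a i = L b i], hence [a = b]. *)

Set Implicit Arguments.
Unset Strict Implicit.
Unset Printing Implicit Defensive.

Import GRing.Theory.
Local Open Scope ring_scope.

Lemma latin_square_row_inj (l : nat) (L : 'M['I_l]_l) (a : 'I_l) :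
  latin_square L -> injective (L a).
Proof.
case=> rowL _ i j Lij; have [x [_ xP]] := rowL a (L a i).
by rewrite -(xP i) // -(xP j).
Qed.

Lemma latin_square_col_inj (l : nat) (L : 'M['I_l]_l) (i : 'I_l) :
  latin_square L -> injective (L^~ i).
Proof.
case=> _ colL a b /= Lab; have [x [_ xP]] := colL i (L a i).
by rewrite -(xP a) // -(xP b).
Qed.

Lemma mem_latin_mset (l r s : nat) (L : 'M['I_l]_l)
    (S : 'I_l -> {mset 'rV[rat]_r}%mset) (T : 'I_l -> {mset 'rV[rat]_s}%mset)
    (a : 'I_l) (x : 'rV[rat]_(r + s)) :
  x \in latin_mset L S T a ->
  exists i : 'I_l, lsubmx x \in S i /\ rsubmx x \in T (L a i).
Proof.
rewrite /latin_mset; elim/big_rec: _ => [|i A _ IHA]; first by rewrite in_mset0.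
rewrite in_msetD => /orP[|/IHA//].
rewrite /mset_concat (perm_mem (perm_eq_seq_mset _)).
by case/allpairsP=> -[u v] /= [uS vT ->]; exists i; rewrite row_mxKl row_mxKr.
Qed.

(** Multiplicities add up under [msetD], and equal counts give a permutation; this lets a
    commutative big operator split over the union. *)
Lemma perm_enum_msetD (K : choiceType) (A B : {mset K}%mset) :
  perm_eq (A `+` B)%mset ((A : seq K) ++ (B : seq K)).
Proof. by apply/allP => x _ /=; rewrite count_cat !count_mem_mset msetE2. Qed.

Section BigLatinMset.
Variables (R : Type) (idx : R) (op : Monoid.com_law idx).

Lemma big_mset_concat (r s : nat) (S : {mset 'rV[rat]_r}%mset)
    (T : {mset 'rV[rat]_s}%mset) (F : 'rV[rat]_(r + s) -> R) :
  \big[op/idx]_(x <- mset_concat S T) F x =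
  \big[op/idx]_(u <- S) \big[op/idx]_(v <- T) F (row_mx u v).
Proof. by rewrite (perm_big _ (perm_eq_seq_mset _)) big_allpairs_dep. Qed.

(** Stated for any commutative monoid so as to serve both the cardinality (a sum of ones in [nat])
    and the moments (sums in [rat]). *)
Lemma big_latin_mset (l r s : nat) (L : 'M['I_l]_l)
    (S : 'I_l -> {mset 'rV[rat]_r}%mset) (T : 'I_l -> {mset 'rV[rat]_s}%mset)
    (a : 'I_l) (F : 'rV[rat]_(r + s) -> R) :
  \big[op/idx]_(x <- latin_mset L S T a) F x =
  \big[op/idx]_(i < l) \big[op/idx]_(u <- S i)
     \big[op/idx]_(v <- T (L a i)) F (row_mx u v).
Proof.
under [RHS]eq_bigr do rewrite -big_mset_concat.
rewrite /latin_mset.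
apply: (big_rec2 (fun (A : {mset 'rV[rat]_(r + s)}%mset) (y : R) =>
    \big[op/idx]_(x <- A) F x = y)) => [|i A y _ IHA].
  by rewrite enum_mset0 big_nil.
by rewrite (perm_big _ (perm_enum_msetD _ _)) big_cat /= IHA.
Qed.

End BigLatinMset.

(** A monomial in concatenated coordinates factors at index [r]; distributivity does the rest. *)
Lemma sum_prod_row_mx (r s : nat) (A : seq 'rV[rat]_r) (B : seq 'rV[rat]_s)
    (k : 'I_(r + s) -> nat) :
  \sum_(u <- A) \sum_(v <- B) \prod_j (row_mx u v) ord0 j ^+ k j =
  (\sum_(u <- A) \prod_j u ord0 j ^+ k (lshift s j)) *
  (\sum_(v <- B) \prod_j v ord0 j ^+ k (rshift r j)).
Proof.
rewrite mulr_suml; apply: eq_bigr => u _; rewrite mulr_sumr.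
apply: eq_bigr => v _; rewrite big_split_ord /=.
by congr (_ * _); apply: eq_bigr => j _; rewrite ?row_mxEl ?row_mxEr.
Qed.

(** Extends the moment equalities to degree 0, where both sides equal [n]. This case arises when an
    exponent of positive total degree vanishes on one of the two blocks. *)
Lemma pte_moment (n m r : nat) (A B : {mset 'rV[rat]_r}%mset) (k : 'I_r -> nat) :
  pte n m A B -> (\sum_(j < r) k j <= m)%N ->
  \sum_(x <- A) \prod_(j < r) x ord0 j ^+ k j =
  \sum_(x <- B) \prod_(j < r) x ord0 j ^+ k j.
Proof.
case=> sA sB _ eqAB kle; have [k0|] := posnP (\sum_(j < r) k j)%N; last first.
  by move=> k_gt0; apply: eqAB; rewrite k_gt0.
have monomial1 (x : 'rV[rat]_r) : \prod_(j < r) x ord0 j ^+ k j = 1.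
  apply: big1 => j _; have /eqP := k0; rewrite sum_nat_eq0.
  by move=> /forallP/(_ j)/eqP->.
rewrite (eq_bigr (fun=> 1)) // [RHS](eq_bigr (fun=> 1)) //.
by rewrite !big_const_seq !count_predT sA sB.
Qed.

Theorem theorem5p8 (l : nat) (hl : (2 <= l)%N)
  (L : 'M['I_l]_l) (hL : latin_square L)
  (nS nT rS rT mS mT : nat)
  (S : 'I_l -> {mset 'rV[rat]_rS}%mset) (T : 'I_l -> {mset 'rV[rat]_rT}%mset)
  (hnS : forall a : 'I_l, size (S a) = nS)
  (hnT : forall a : 'I_l, size (T a) = nT)
  (hS : forall a b : 'I_l, a <> b -> pte nS mS (S a) (S b))
  (hT : forall a b : 'I_l, a <> b -> pte nT mT (T a) (T b)) :
  forall a b : 'I_l, a <> b ->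
    pte (l * nS * nT)%N (mS + mT + 1)%N (latin_mset L S T a) (latin_mset L S T b).
Proof.
move=> a b neq_ab.
have size_latin c : size (latin_mset L S T c) = (l * nS * nT)%N.
  rewrite -sum1_size big_latin_mset /=.
  under eq_bigr do under eq_bigr do rewrite sum1_size hnT.
  under eq_bigr do rewrite big_const_seq count_predT iter_addn_0 hnS.
  by rewrite sum_nat_const card_ord mulnA mulnAC.
split=> [||x|k /andP[_ k_le]] //.
  case=> /mem_latin_mset[i [xSi xTi]] /mem_latin_mset[j [xSj xTj]].
  have [eq_ij|/eqP neq_ij] := eqVneq i j; last first.
    by have [_ _ disj _] := hS _ _ neq_ij; apply: (disj (lsubmx x)).
  rewrite -{j}eq_ij in xSj xTj.
  have /hT[_ _ disj _] : L a i <> L b i.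
    by move=> /(latin_square_col_inj hL).
  exact: (disj (rsubmx x)).
rewrite !big_latin_mset /=.
under eq_bigr do rewrite sum_prod_row_mx.
under [RHS]eq_bigr do rewrite sum_prod_row_mx.
set P := fun i => \sum_(u <- S i) \prod_j u ord0 j ^+ k (lshift rT j).
set Q := fun c => \sum_(v <- T c) \prod_j v ord0 j ^+ k (rshift rS j).
rewrite -/(\sum_(i < l) P i * Q (L a i)) -/(\sum_(i < l) P i * Q (L b i)).
(* Row [c] is a permutation of the symbols. *)
have sumQ c : \sum_(i < l) Q (L c i) = \sum_(i < l) Q i.
  by rewrite [RHS](reindex_inj (latin_square_row_inj (a := c) hL)).
rewrite big_split_ord /= in k_le.
have [kS_le|kS_gt] := leqP (\sum_(j < rS) k (lshift rT j)) mS.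
  have constP i : P i = P a.
    have [->//|/eqP/hS pteS] := eqVneq i a; exact: (pte_moment pteS).
  under eq_bigr do rewrite constP.
  under [RHS]eq_bigr do rewrite constP.
  by rewrite -!mulr_sumr !sumQ.
have kT_le : (\sum_(j < rT) k (rshift rS j) <= mT)%N.
  (* The [S]-block has degree at least [mS.+1], out of a total of at most [mS + mT + 1], which
     leaves at most [mT]. *)
  rewrite -(leq_add2l mS.+1) [leqRHS]addSn -[leqRHS]addn1.
  by apply: leq_trans k_le; rewrite leq_add2r.
have constQ c : Q c = Q a.
  have [->//|/eqP/hT pteT] := eqVneq c a; exact: (pte_moment pteT).
by apply: eq_bigr => i _; rewrite constQ [Q (L b i)]constQ.
Qed.
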